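(* Let $\mathcal{H}$ be a real Hilbert space with inner product $\langle\cdot,\cdot\rangle$ and norm $\|\cdot\|$. Let $\Phi:\mathcal{H}\to\mathbb{R}$ be a convex $C^1$ function such that $\arg\min\Phi=\{v\in\mathcal{H}:\Phi(v)=\Phi^*\}$ is nonempty, where $\Phi^*=\min_{x\in\mathcal{H}}\Phi(x)$. Let $c>0$, $\alpha\in[0,1)$, $\gamma(t)=\frac{c}{(1+t)^\alpha}$, and $g\in L^1(0,+\infty;\mathcal{H})$. Let $x\in W^{2,1}_{loc}(0,+\infty;\mathcal{H})$ be a solution of $$\ddot x(t)+\gamma(t)\dot x(t)+\nabla\Phi(x(t))=g(t),\quad t\ge 0.$$ Assume that $\int_0^{+\infty}(1+t)^\alpha\|g(t)\|\,dt<\infty$ and that the interior of $\arg\min\Phi$ is nonempty. Then there exists $x^*\in\arg\min\Phi$ such that $x(t)\to x^*$ strongly in $\mathcal{H}$ as $t\to+\infty$.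
   Context: $W^{2,1}_{loc}(0,+\infty;\mathcal{H})$ denotes functions whose first and second (weak) derivatives are locally integrable with values in $\mathcal{H}$; $\dot x,\ddot x$ denote the first and second time derivatives. *)

(* Defs.v *)
From HB Require Import structures.
From mathcomp Require Import all_boot all_order all_algebra.
From mathcomp Require Import all_classical all_reals all_analysis.
Set Implicit Arguments. Unset Strict Implicit. Unset Printing Implicit Defensive.
Import Order.TTheory GRing.Theory Num.Theory.
Import numFieldNormedType.Exports.
Local Open Scope classical_set_scope.
Local Open Scope ring_scope.

Definition is_inner_product {R : realType} {H : normedModType R}
  (ip : H -> H -> R) : Prop :=
  [/\ (forall x y, ip x y = ip y x),
      (forall a x y z, ip (a *: x + y) z = a * ip x z + ip y z) &
      (forall x, ip x x = `|x| ^+ 2)].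

Definition abs_cont_on {R : realType} {V : normedModType R}
  (a b : R) (f : R -> V) : Prop :=
  forall e : R, 0 < e -> exists2 d : R, 0 < d &
    forall (n : nat) (l r : nat -> R),
      (forall i, (i < n)%N -> a <= l i /\ l i <= r i /\ r i <= b) ->
      (forall i j, (i < n)%N -> (j < n)%N -> i <> j -> r i <= l j \/ r j <= l i) ->
      \sum_(i < n) (r i - l i) < d ->
      \sum_(i < n) `|f (r i) - f (l i)| < e.

(* x belongs to W^{2,1}_loc([0,+oo); H) with x' = v: x and v are absolutely
   continuous on every [0,T] and v is the a.e. derivative of x. (In a Hilbert
   space, which has the Radon-Nikodym property, W^{1,1}(0,T;H) coincides with
   the absolutely continuous functions, which are a.e. differentiable.) *)
Definition W21loc {R : realType} {V : normedModType R} (x v : R -> V) : Prop :=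
  [/\ (forall T, 0 < T -> abs_cont_on 0 T x),
      (forall T, 0 < T -> abs_cont_on 0 T v) &
      {ae (@lebesgue_measure R), forall t : R, 0 < t -> is_derive t (1 : R) x (v t)}].

(* Main.v *)
(** Write [p = (1 + t)^alpha / c], the inverse of the damping, and let the closed
    ball of centre [z] and radius [rho] consist of minimizers.  Convexity then
    gives [rho |grad Phi (x)| <= <grad Phi (x), x - z>], so that for large [t]
      [J = 4 p^2 (|x'|^2 / 2 + Phi (x) - min Phi) + p <x', x - z>
           + (1 - p') |x - z|^2 / 2 + (rho / 4) p |x'|]
    dominates [(p |x'|)^2 / 2 + |x - z|^2 / 4] and satisfies, almost everywhere
    and in the sense of upper right Dini derivatives,
      [J' <= - (rho / 8) |x'| - (rho / 4) p |grad Phi (x)|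
             + p |g| (4 p |x'| + |x - z| + rho / 4) - p'' |x - z|^2 / 2].
    As [p |g|] is integrable and [p'] decreases to a small value, [J] stays
    bounded.  Up to a bounded correction [J] therefore decreases faster than
    [(rho / 8) |x'|], which makes [x] Cauchy, and faster than a multiple of
    [|grad Phi (x)|], which forces the gradient to vanish at the limit.

    Almost everywhere differential inequalities are integrated through
    [abs_cont_dini_le]: an absolutely continuous function whose upper right
    Dini derivative is almost everywhere nonpositive does not increase. *)
Require Import Defs.
From HB Require Import structures.
From mathcomp Require Import all_boot all_order all_algebra.
From mathcomp Require Import all_classical all_reals all_analysis.
From mathcomp Require Import measurable_realfun ring lra.
Import Order.TTheory GRing.Theory Num.Theory.
Import numFieldNormedType.Exports.
Local Open Scope classical_set_scope.
Local Open Scope ring_scope.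

(** * Monotonicity from almost everywhere Dini bounds *)

(* The upper right Dini derivative of [f] at [t] is at most [d]. *)
Definition dini_le {R : realType} (f : R -> R) (t d : R) : Prop :=
  forall e, 0 < e -> exists2 s0, 0 < s0 &
    forall s, 0 < s < s0 -> f (t + s) - f t <= (d + e) * s.

Lemma abs_cont_on_unif {R : realType} {V : normedModType R} (a b : R)
    (f : R -> V) (e : R) :
  abs_cont_on a b f -> 0 < e ->
  exists2 d, 0 < d & forall s t, a <= s <= b -> a <= t <= b ->
    `|s - t| < d -> `|f s - f t| < e.
Proof.
move=> ac e0; have [d d0 dP] := ac _ e0.
exists d => //.
suff key s t : a <= s <= b -> a <= t <= b -> s <= t -> t - s < d ->
    `|f t - f s| < e.
  move=> s t sab tab; have [st|ts] := leP s t.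
    by rewrite distrC ger0_norm ?subr_ge0// distrC; exact: key.
  by rewrite ger0_norm ?subr_ge0 ?ltW//; apply: key => //; exact: ltW.
move=> /andP[as_ sb] /andP[at_ tb] st std.
have := dP 1%N (fun=> s) (fun=> t).
rewrite !big_ord1; apply => //.
by move=> [|i] [|j].
Qed.

(** The closed intervals may share endpoints, but their interiors are disjoint subsets of [U] of the
    same lengths, so additivity and monotonicity of the measure apply to these. *)
Lemma sum_length_le_measure {R : realType} (U : set R) (n : nat)
    (l r : nat -> R) :
  open U ->
  (forall i, (i < n)%N -> l i <= r i) ->
  (forall i j, (i < n)%N -> (j < n)%N -> i <> j -> r i <= l j \/ r j <= l i) ->
  (forall i y, (i < n)%N -> l i <= y <= r i -> U y) ->
  ((\sum_(i < n) (r i - l i))%:E <= @lebesgue_measure R U)%E.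
Proof.
move=> oU lr disj lrU.
pose F i : set R := `]l i, r i[%classic.
have mF i : measurable (F i) by exact: measurable_itv.
have tF : trivIset `I_n F.
  apply/trivIsetP => i j /= ni nj /eqP ij; rewrite -subset0 => y [].
  rewrite /F /= !in_itv/= => /andP[a1 a2] /andP[b1 b2].
  have [h|h] := disj _ _ ni nj ij.
    by move: (lt_trans b1 (lt_le_trans a2 h)); rewrite ltxx.
  by move: (lt_trans a1 (lt_le_trans b2 h)); rewrite ltxx.
rewrite [leLHS](_ : _ = (@lebesgue_measure R) (\big[setU/set0]_(i < n) F i)).
  apply: le_measure; rewrite ?inE//.
  - by apply: bigsetU_measurable => i _; exact: mF.
  - exact: open_measurable.
  - rewrite -bigcup_mkord => y [i /= ni]; rewrite /F/= in_itv/= => /andP[h1 h2].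
    by apply: (lrU i) => //; rewrite !ltW.
rewrite measure_semi_additive_ord_I//=; last 2 first.
- by move=> i _; exact: mF.
- by apply: bigsetU_measurable => i _; exact: mF.
rewrite -[LHS]sumEFin; apply: eq_bigr => i _.
rewrite lebesgue_measure_itv/= lte_fin -EFinD.
case: ltP => // h; congr EFin; apply/eqP.
by rewrite subr_eq0 eq_le h lr.
Qed.

(* Cover the exceptional null set by an open [U] of small measure and let [V t]
   be the supremum of the variation of [f] over finite families of disjoint
   intervals contained in [U] and in [[a, t]]; [V] is small by absolute
   continuity.  The last point where [f t - f a <= e (t - a) + V t] must be
   [b]: outside [U] the Dini derivative allows to move on, inside [U] the growth
   of [V] does. *)
Lemma abs_cont_dini_le {R : realType} (a b : R) (f : R -> R) :
  a <= b -> abs_cont_on a b f ->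
  {ae (@lebesgue_measure R), forall t, a <= t < b -> dini_le f t 0} ->
  f b <= f a.
Proof.
move=> ab ac [A [mA A0 NA]].
(* [e * (b - a)] allows for a rise at slope [e]; the last [e] allows for the variation inside a
   small open set around the exceptional points. *)
suff key e : 0 < e -> f b - f a <= e * (b - a) + e.
  rewrite -subr_le0; apply/ler_addgt0Pr => e e0; rewrite add0r.
  have k0 : 0 < b - a + 1 by lra.
  apply: le_trans (key (e / (b - a + 1)) (divr_gt0 e0 k0)) _.
  have -> : e / (b - a + 1) * (b - a) + e / (b - a + 1) =
            e / (b - a + 1) * (b - a + 1) by ring.
  by rewrite divfK // gt_eqF.
move=> e0.
have [d d0 dP] := ac _ e0.
have [U [oU AU UAd]] : exists U : set R,
    [/\ open U, A `<=` U & ((@lebesgue_measure R) (U `\` A) < d%:E)%E].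
  by apply: lebesgue_regularity_outer => //; rewrite [X in (X < _)%E]A0 ltry.
have Ud : ((@lebesgue_measure R) U < d%:E)%E.
  apply: le_lt_trans UAd.
  have mU : measurable U by exact: open_measurable.
  rewrite -[leLHS](congr1 (@lebesgue_measure R) (setDUK AU)).
  apply: (le_trans (measureU2 _ _ _ )) => //.
    exact: measurableD.
  by rewrite [X in (X + _)%E]A0 add0e.
pose fam t n (l r : nat -> R) :=
  [/\ forall i, (i < n)%N -> a <= l i /\ l i <= r i /\ r i <= t,
   forall i j, (i < n)%N -> (j < n)%N -> i <> j -> r i <= l j \/ r j <= l i &
   forall i y, (i < n)%N -> l i <= y <= r i -> U y].
pose S t := [set y : R | exists n l r,
  fam t n l r /\ y = \sum_(i < n) `|f (r i) - f (l i)|].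
pose V t := sup (S t).
have S0 t : S t 0.
  by exists 0%N, (fun=> 0), (fun=> 0); rewrite big_ord0; split => //; split.
have Sle t y : t <= b -> S t y -> y <= e.
  move=> tb [n [l [r [[h1 h2 h3] ->]]]]; apply/ltW/dP => //.
    move=> i ni; have [? [? ?]] := h1 i ni; split=> //; split=> //.
    exact: le_trans tb.
  rewrite -lte_fin; apply: le_lt_trans Ud.
  by apply: sum_length_le_measure => // i ni; have [_ []] := h1 i ni.
have Shas t : t <= b -> has_sup (S t).
  by move=> tb; split; [exists 0; exact: S0|exists e => y; exact: Sle].
have V0 t : t <= b -> 0 <= V t by move=> tb; apply: ub_le_sup => //; apply: (Shas t tb).2.
have Vle t : t <= b -> V t <= e.
  by move=> tb; apply: ge_sup; [exists 0; exact: S0|move=> y; exact: Sle].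
have Vmon s t : s <= t -> t <= b -> V s <= V t.
  move=> st tb; apply: ge_sup; first by exists 0; exact: S0.
  move=> y [n [l [r [[h1 h2 h3] ->]]]]; apply: ub_le_sup; first exact: (Shas t tb).2.
  exists n, l, r; split=> //; split=> // i ni; have [? [? ?]] := h1 i ni.
  by split=> //; split=> //; exact: le_trans st.
have Vstep s t : a <= s -> s <= t -> t <= b -> (forall y, s <= y <= t -> U y) ->
    V s + `|f t - f s| <= V t.
  move=> as_ st tb stU; rewrite -lerBrDr.
  apply: ge_sup; first by exists 0; exact: S0.
  move=> y [n [l [r [[h1 h2 h3] ->]]]]; rewrite lerBrDr.
  apply: ub_le_sup; first exact: (Shas t tb).2.
  (* [[s, t]] is appended with index [n]; the older intervals end at [s] or before. *)
  exists n.+1, (fun i => if i == n then s else l i),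
    (fun i => if i == n then t else r i); split; last first.
    rewrite big_ord_recr/= eqxx; congr (_ + _); apply: eq_bigr => i _.
    by rewrite !ifF//; apply/negbTE; rewrite neq_ltn ltn_ord.
  split.
  - move=> i; case: eqP => [-> _|/eqP ni]; first by [].
    rewrite ltnS leq_eqVlt (negbTE ni)/= => {}ni.
    have [? [? ?]] := h1 i ni; split=> //; split=> //; exact: le_trans st.
  - move=> i j.
    case: eqP => [->|/eqP ni]; case: eqP => [->|/eqP nj] //.
    + rewrite !ltnS (leq_eqVlt j) (negbTE nj)/= => _ {}nj _.
      by right; have [? [? ?]] := h1 j nj.
    + rewrite !ltnS (leq_eqVlt i) (negbTE ni)/= => {}ni _ _.
      by left; have [? [? ?]] := h1 i ni.
    + rewrite !ltnS (leq_eqVlt i) (leq_eqVlt j) (negbTE ni) (negbTE nj)/=.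
      exact: h2.
  - move=> i y'; case: eqP => [-> _|/eqP ni]; first exact: stU.
    rewrite ltnS leq_eqVlt (negbTE ni)/= => {}ni.
    exact: h3.
pose G := [set t | a <= t <= b /\ f t - f a <= e * (t - a) + V t].
have Ga : G a.
  by split; [rewrite lexx|rewrite !subrr mulr0 add0r V0].
have hG : has_sup G by split; [exists a|exists b => t [/andP[]]].
pose c := sup G.
have ac_ : a <= c by apply: ub_le_sup => //; exact: hG.2.
have cb : c <= b by apply: ge_sup => [|t [/andP[]]//]; exists a.
(* The inequality passes to the supremum because [f] is continuous and [V] is nondecreasing. *)
have Gc : f c - f a <= e * (c - a) + V c.
  apply/ler_addgt0Pr => h h0.
  have [k k0 kP] := abs_cont_on_unif _ _ _ _ ac h0.
  have [t Gt tc] := sup_adherent k0 hG.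
  have [/andP[a_t tb] Gt2] := Gt.
  have tc2 : t <= c by apply: ub_le_sup => //; exact: hG.2.
  have : `|f c - f t| < h.
    apply: kP; rewrite ?ac_ ?a_t ?tb ?cb// ger0_norm ?subr_ge0//.
    rewrite -/c in tc; lra.
  move=> /(le_lt_trans (ler_norm _)) fct.
  have := Vmon _ _ tc2 cb.
  have : e * (t - a) <= e * (c - a) by rewrite ler_pM2l//; lra.
  lra.
have [<-|cneb] := eqVneq c b; first by have := Vle _ cb; lra.
have {cneb}cb' : c < b by rewrite lt_neqAle cneb.
exfalso.
(* Such a step would put [c + s] in [G], beyond its supremum. *)
suff [s s0 [sb fs]] : exists2 s, 0 < s & c + s <= b /\
    f (c + s) - f c <= e * s + V (c + s) - V c.
  have : G (c + s).
    split; first by rewrite sb andbT; lra.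
    rewrite (_ : e * (c + s - a) = e * (c - a) + e * s); [lra|ring].
  move=> /(ub_le_sup hG.2); rewrite -/c; lra.
have [dc|ndc] := pselect (dini_le f c 0).
  have [s0 s00 s0P] := dc _ e0.
  pose s := Num.min (s0 / 2) (b - c).
  have ss : 0 < s by rewrite /s lt_min; apply/andP; split; lra.
  have ss0 : s <= s0 / 2 by rewrite ge_min lexx.
  have sb : s <= b - c by rewrite ge_min lexx orbT.
  exists s => //; split; first by lra.
  have := s0P s; rewrite add0r => /(_ _)/le_trans; apply; first lra.
  rewrite -addrA lerDl subr_ge0; apply: Vmon; lra.
have : U c.
  apply: AU; apply: NA => /= h; apply: ndc; apply: h; lra.
move=> /(open_subball oU) [s0 /= s00 s0P].
pose s := Num.min (s0 / 2) (b - c).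
have ss : 0 < s by rewrite /s lt_min; apply/andP; split; lra.
have ss0 : s <= s0 / 2 by rewrite ge_min lexx.
have sb : s <= b - c by rewrite ge_min lexx orbT.
exists s => //; split; first by lra.
have : V c + `|f (c + s) - f c| <= V (c + s).
  apply: Vstep; try lra.
  move=> y /andP[cy ycs].
  (* A radius below [s0] whose open ball contains [[c, c + s]], as [s <= s0 / 2]. *)
  apply: (s0P (s0 * (3/4))) => /=.
  - by rewrite /ball/= sub0r normrN gtr0_norm; lra.
  - lra.
  - by rewrite /ball/= distrC ger0_norm; lra.
have := ler_norm (f (c + s) - f c).
have : 0 <= e * s by rewrite mulr_ge0// ltW.
lra.
Qed.

(** * Calculus of absolutely continuous functions *)

Lemma abs_cont_onS {R : realType} {V : normedModType R} (a b a' b' : R)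
    (f : R -> V) :
  a <= a' -> b' <= b -> abs_cont_on a b f -> abs_cont_on a' b' f.
Proof.
move=> aa bb ac e /ac[d d0 dP]; exists d => // n l r h; apply: dP.
move=> i /h[h1 [h2 h3]]; split; first exact: le_trans h1.
by split=> //; exact: le_trans bb.
Qed.

(** Common source of the closure properties below: each reduces to a pointwise bound on
    increments. *)
Lemma abs_cont_on_dominated {R : realType} {V1 V2 V : normedModType R}
    (a b C : R) (f1 : R -> V1) (f2 : R -> V2) (f : R -> V) :
  abs_cont_on a b f1 -> abs_cont_on a b f2 ->
  (forall s t, a <= s <= b -> a <= t <= b ->
    `|f t - f s| <= C * (`|f1 t - f1 s| + `|f2 t - f2 s|)) ->
  abs_cont_on a b f.
Proof.
move=> ac1 ac2 fC e e0.
have C0 : 0 < `|C| + 1 by rewrite ltr_wpDl.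
have e1 : 0 < e / (2 * (`|C| + 1)) by rewrite divr_gt0// mulr_gt0.
have [d1 d10 d1P] := ac1 _ e1; have [d2 d20 d2P] := ac2 _ e1.
exists (Num.min d1 d2); first by rewrite lt_min d10.
move=> n l r h1 h2; rewrite lt_min => /andP[hd1 hd2].
have := d1P n l r h1 h2 hd1; have := d2P n l r h1 h2 hd2.
set S1 := (X in _ -> X < _ -> _); set S2 := (X in X < _ -> _) => S2e S1e.
apply: (@le_lt_trans _ _ ((`|C| + 1) * (S1 + S2))).
  rewrite -big_split/= mulr_sumr; apply: ler_sum => i _.
  have [h3 [h4 h5]] := h1 i (ltn_ord i).
  apply: (le_trans (fC _ _ _ _)).
  - by rewrite h3 (le_trans h4).
  - by rewrite h5 (le_trans h3).
  - by rewrite ler_wpM2r ?addr_ge0// (le_trans (ler_norm _))// lerDl.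
apply: (@lt_le_trans _ _ ((`|C| + 1) * (e / (2 * (`|C| + 1)) + e / (2 * (`|C| + 1))))).
  by rewrite ltr_pM2l// ltrD.
rewrite le_eqVlt; apply/orP; left; apply/eqP; field.
by rewrite gt_eqF.
Qed.

Lemma abs_cont_on_lip {R : realType} {V : normedModType R} (a b C : R)
    (f : R -> V) :
  (forall s t, a <= s <= b -> a <= t <= b -> `|f t - f s| <= C * `|t - s|) ->
  abs_cont_on a b f.
Proof.
move=> fC.
have acid : abs_cont_on a b (@id R).
  move=> e e0; exists e => // n l r h1 h2; apply: le_lt_trans.
  apply: ler_sum => i _; rewrite ger0_norm// subr_ge0.
  by have [_ []] := h1 i (ltn_ord i).
apply: (@abs_cont_on_dominated _ R R V a b `|C| id id f) => // s t sab tab.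
apply: (le_trans (fC _ _ sab tab)).
apply: (@le_trans _ _ (`|C| * `|t - s|)); first by rewrite ler_wpM2r ?ler_norm.
by rewrite ler_wpM2l// lerDl.
Qed.

Lemma abs_cont_on_within_continuous {R : realType} {V : normedModType R}
    (a b : R) (f : R -> V) :
  abs_cont_on a b f -> {within `[a, b], continuous f}.
Proof.
move=> ac; apply/subspace_continuousP => t; rewrite /= in_itv/= => tab.
apply/cvgrPdist_lt => e e0; have [d d0 dP] := abs_cont_on_unif _ _ _ _ ac e0.
rewrite near_withinE; near=> s; rewrite /= in_itv/= => sab.
by apply: dP => //; near: s.
Unshelve. all: by end_near. Qed.

Lemma within_continuous_norm_bounded {R : realType} {V : normedModType R}
    (a b : R) (f : R -> V) :
  {within `[a, b], continuous f} ->
  exists M, forall t, a <= t <= b -> `|f t| <= M.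
Proof.
move=> cf; have [ab|ba] := leP a b; last first.
  by exists 0 => t tab; lra.
have cnf : {within `[a, b], continuous (fun t => `|f t|)}.
  move=> t; apply: continuous_comp; first exact: cf.
  exact: norm_continuous.
have [c _ cP] := EVT_max ab cnf.
by exists `|f c| => t tab; apply: cP; rewrite in_itv.
Qed.

Lemma abs_cont_on_bounded {R : realType} {V : normedModType R}
    (a b : R) (f : R -> V) :
  abs_cont_on a b f -> exists M, forall t, a <= t <= b -> `|f t| <= M.
Proof.
by move=> /abs_cont_on_within_continuous/within_continuous_norm_bounded.
Qed.

Lemma abs_cont_onD {R : realType} {V : normedModType R} (a b : R)
    (f g : R -> V) :
  abs_cont_on a b f -> abs_cont_on a b g ->
  abs_cont_on a b (fun t => f t + g t).
Proof.
move=> acf acg; apply: (@abs_cont_on_dominated _ _ _ _ a b 1 f g) => // s t _ _.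
by rewrite mul1r (_ : _ - _ = f t - f s + (g t - g s)) ?ler_normD// addrACA opprD.
Qed.

(** An increment of [op (f t) (g t)] splits into one increment of [f] and one of [g], with factors
    bounded on [[a, b]]. Products, scalings and inner products are instances. *)
Lemma abs_cont_on_bilinear {R : realType} {V1 V2 V : normedModType R}
    (op : V1 -> V2 -> V) (a b : R) (f : R -> V1) (g : R -> V2) :
  (forall u u' w, op (u - u') w = op u w - op u' w) ->
  (forall u w w', op u (w - w') = op u w - op u w') ->
  (forall u w, `|op u w| <= `|u| * `|w|) ->
  abs_cont_on a b f -> abs_cont_on a b g ->
  abs_cont_on a b (fun t => op (f t) (g t)).
Proof.
move=> opl opr opn acf acg.
have [M MP] := abs_cont_on_bounded _ _ _ acf.
have [N NP] := abs_cont_on_bounded _ _ _ acg.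
apply: (@abs_cont_on_dominated _ _ _ _ a b (`|M| + `|N|) f g) => // s t sab tab.
rewrite (_ : _ - _ = op (f t - f s) (g t) + op (f s) (g t - g s)); last first.
  by rewrite opl opr addrA subrK.
apply: (le_trans (ler_normD _ _)).
have hM : `|f s| <= `|M| by rewrite (le_trans (MP _ sab))// ler_norm.
have hN : `|g t| <= `|N| by rewrite (le_trans (NP _ tab))// ler_norm.
rewrite mulrDr; apply: lerD; apply: (le_trans (opn _ _)).
  by rewrite mulrC ler_wpM2r// (le_trans hN)// lerDr.
by rewrite ler_wpM2r// (le_trans hM)// lerDl.
Qed.

Lemma abs_cont_onM {R : realType} (a b : R) (f g : R -> R) :
  abs_cont_on a b f -> abs_cont_on a b g ->
  abs_cont_on a b (fun t => f t * g t).
Proof.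
apply: (@abs_cont_on_bilinear R R R R (fun x y => x * y)) => *.
- exact: mulrBl.
- exact: mulrBr.
- by rewrite normrM.
Qed.

Lemma abs_cont_onZ {R : realType} {V : normedModType R} (a b : R)
    (f : R -> R) (g : R -> V) :
  abs_cont_on a b f -> abs_cont_on a b g ->
  abs_cont_on a b (fun t => f t *: g t).
Proof.
apply: (@abs_cont_on_bilinear R R V V (fun x y => x *: y)) => *.
- exact: scalerBl.
- exact: scalerBr.
- by rewrite normrZ.
Qed.

Lemma abs_cont_on_cst {R : realType} {V : normedModType R} (a b : R) (k : V) :
  abs_cont_on a b (fun=> k).
Proof.
by apply: (@abs_cont_on_lip _ _ _ _ 0) => s t _ _; rewrite subrr normr0 mul0r.
Qed.

Lemma abs_cont_on_norm {R : realType} {V : normedModType R} (a b : R)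
    (f : R -> V) :
  abs_cont_on a b f -> abs_cont_on a b (fun t => `|f t|).
Proof.
move=> ac; apply: (@abs_cont_on_dominated _ _ _ _ a b 1 f f) => // s t _ _.
by rewrite mul1r (le_trans (ler_dist_dist _ _))// lerDl.
Qed.

(** * Calculus of Dini bounds *)

Lemma is_derive_right_expansion {R : realType} {V : normedModType R}
    (f : R -> V) (t : R) (d : V) (e : R) :
  is_derive t 1 f d -> 0 < e ->
  exists2 s0, 0 < s0 & forall s, 0 < s < s0 ->
    `|f (t + s) - f t - s *: d| <= e * s.
Proof.
move=> [df <-] e0.
move: df => /cvgrPdist_le/(_ _ e0)[s0 /= s00 s0P].
exists s0 => // s /andP[s_gt0 ss0].
have := s0P s; rewrite /= sub0r normrN gtr0_norm// gt_eqF// => /(_ ss0 isT).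
rewrite scaler1 [s + t]addrC -/('D_1 f t) => h.
rewrite -(ler_pM2l s_gt0) in h.
rewrite -[X in X * `|_|](gtr0_norm s_gt0) -normrZ scalerBr scalerA in h.
by rewrite divff ?gt_eqF// scale1r distrC [s * e]mulrC in h.
Qed.

Lemma dini_le_is_derive {R : realType} (f : R -> R) (t d : R) :
  is_derive t 1 f d -> dini_le f t d.
Proof.
move=> df e e0; have [s0 s00 s0P] := is_derive_right_expansion _ _ _ _ df e0.
exists s0 => // s /s0P /(le_trans (ler_norm _)).
by rewrite mulrDl lerBlDl -[s *: d]/(s * d) [d * s]mulrC.
Qed.

Lemma dini_le_trans {R : realType} (f : R -> R) (t d d' : R) :
  d <= d' -> dini_le f t d -> dini_le f t d'.
Proof.
move=> dd h e /h[s0 s00 s0P]; exists s0 => // s ss; apply: (le_trans (s0P _ ss)).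
by rewrite ler_wpM2r ?lerD2r//; case/andP: ss => /ltW.
Qed.

Lemma dini_leD {R : realType} (f g : R -> R) (t d d' : R) :
  dini_le f t d -> dini_le g t d' -> dini_le (fun s => f s + g s) t (d + d').
Proof.
move=> hf hg e e0; have e2 : 0 < e / 2 by rewrite divr_gt0.
have [s1 s10 s1P] := hf _ e2; have [s2 s20 s2P] := hg _ e2.
exists (Num.min s1 s2); first by rewrite lt_min s10.
move=> s; rewrite lt_min => /andP[s0 /andP[ss1 ss2]].
have := s1P s; rewrite s0 ss1 => /(_ isT) h1.
have := s2P s; rewrite s0 ss2 => /(_ isT) h2.
lra.
Qed.

Lemma dini_leZ {R : realType} (k : R) (f : R -> R) (t d : R) :
  0 < k -> dini_le f t d -> dini_le (fun s => k * f s) t (k * d).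
Proof.
move=> k0 hf e e0; have [s0 s00 s0P] := hf _ (divr_gt0 e0 k0).
exists s0 => // s /s0P h; rewrite -mulrBr.
have -> : (k * d + e) * s = k * ((d + e / k) * s) by field; rewrite gt_eqF.
by rewrite ler_pM2l.
Qed.

(* The term [- k *: u t] of the derivative is kept apart: at distance [s] it
   turns [u t] into [(1 - s k) *: u t], which shortens it if [0 < k]. *)
Lemma dini_le_norm {R : realType} {V : normedModType R} (u : R -> V)
    (t k : R) (w : V) :
  is_derive t 1 u (- k *: u t + w) ->
  dini_le (fun s => `|u s|) t (- k * `|u t| + `|w|).
Proof.
move=> du e e0; have [s0 s00 s0P] := is_derive_right_expansion _ _ _ _ du e0.
have k0 : 0 < `|k| + 1 by rewrite ltr_wpDl.
(* The second bound keeps [1 - s * k] nonnegative, so that it comes out of the norm unchanged. *)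
exists (Num.min s0 (`|k| + 1)^-1); first by rewrite lt_min s00 invr_gt0.
move=> s; rewrite lt_min => /andP[s_gt0 /andP[ss0 sk]].
have := s0P s; rewrite s_gt0 ss0 => /(_ isT) h.
have sk1 : 0 <= 1 - s * k.
  rewrite subr_ge0; apply: (@le_trans _ _ (s * (`|k| + 1))).
    by rewrite ler_pM2l// (le_trans (ler_norm _))// lerDl.
  by rewrite -ler_pdivlMr// div1r ltW.
have -> : u (t + s) = (u (t + s) - u t - s *: (- k *: u t + w)) +
    ((1 - s * k) *: u t + s *: w).
  rewrite scalerDr scalerA mulrN scaleNr scalerBl scale1r opprD opprK.
  have zE (A B C D : V) : A = A - B + (C - D) + (B - C + D).
    have -> : B - C + D = B - (C - D) by rewrite opprB addrA addrAC.
    by rewrite addrACA subrK subrr addr0.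
  exact: zE.
have := ler_normD (u (t + s) - u t - s *: (- k *: u t + w))
                  ((1 - s * k) *: u t + s *: w).
have := ler_normD ((1 - s * k) *: u t) (s *: w).
rewrite !normrZ (ger0_norm sk1) (gtr0_norm s_gt0).
lra.
Qed.

(** * Primitives of nonnegative integrable functions *)

Section primitive.
Context {R : realType}.
Notation mu := (@lebesgue_measure R).
Variable k : R -> R.
Hypothesis k0 : forall t, 0 <= k t.
Hypothesis kint : mu.-integrable setT (EFin \o k).

(** The base point [-oo] gives bounds valid at every [t]: nonnegative, and at most the total
    integral. *)
Definition primitive (t : R) : R := (\int[mu]_(y in `]-oo, t]) k y)%R.

Let kintS (A : set R) : measurable A -> mu.-integrable A (EFin \o k).
Proof. by move=> mA; apply: integrableS kint. Qed.

Lemma primitiveB (s t : R) : s <= t ->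
  primitive t - primitive s = (\int[mu]_(y in `]s, t]) k y)%R.
Proof.
move=> st; rewrite /primitive Rintegral_itvB ?bnd_simp//.
exact: kintS.
Qed.

Lemma primitive_ge0 (t : R) : 0 <= primitive t.
Proof. by apply: Rintegral_ge0 => y _. Qed.

Lemma primitive_le_total (t : R) : primitive t <= (\int[mu]_y k y)%R.
Proof.
rewrite /primitive /Rintegral fine_le//.
- by apply: integrable_fin_num => //; exact: kintS.
- by apply: integrable_fin_num.
- apply: ge0_subset_integral => //=.
    by case/integrableP: kint.
  by move=> x _; rewrite lee_fin.
Qed.

(** The increments add up to the integral of [k] over the union of the intervals, which is small
    when the measure of that union is. *)
Lemma abs_cont_on_primitive (a b : R) : abs_cont_on a b primitive.
Proof.
move=> e e0; have [d [d0 dP]] := integral_normr_continuous kint e0.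
exists d => // n l r h1 h2 hd.
have lr (i : 'I_n) : l i <= r i by have [_ []] := h1 i (ltn_ord i).
pose F (i : 'I_n) : set R := `]l i, r i]%classic.
have mF i : measurable (F i) by exact: measurable_itv.
have tF : trivIset setT F.
  apply/trivIsetP => i j _ _ ij; rewrite -subset0 => y [].
  rewrite /F /= !in_itv/= => /andP[a1 a2] /andP[b1 b2].
  have ij' : i <> j :> nat by move=> /val_inj/eqP; rewrite (negbTE ij).
  have [h|h] := h2 _ _ (ltn_ord i) (ltn_ord j) ij'.
    by move: (lt_le_trans b1 (le_trans a2 h)); rewrite ltxx.
  by move: (lt_le_trans a1 (le_trans b2 h)); rewrite ltxx.
pose D := \big[setU/set0]_(i < n) F i.
have mD : measurable D by apply: bigsetU_measurable => i _; exact: mF.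
have muD : mu D = (\sum_(i < n) (r i - l i))%:E.
  rewrite /D measure_semi_additive_ord//= -[RHS]sumEFin.
  apply: eq_bigr => i _; rewrite lebesgue_measure_itv/= lte_fin -EFinD.
  case: ltP => // h; congr EFin; apply/eqP.
  by rewrite eq_sym subr_eq0 eq_le h lr.
have := dP D mD; rewrite [X in (X < _)%E]muD lte_fin => /(_ hd).
suff -> : (\int[mu]_(x in D) `|k x|)%R =
    \sum_(i < n) `|primitive (r i) - primitive (l i)| by [].
rewrite /Rintegral.
under eq_integral do rewrite ger0_norm//.
rewrite integral_bigsetU_EFin//=; last 3 first.
- exact: index_enum_uniq.
- by apply: sub_trivIset tF.
- by case/integrableP: (kintS _ mD).
rewrite -sum_fine; last first.
  by move=> i _; apply: integrable_fin_num; [exact: mF|exact: (kintS _ (mF i))].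
apply: eq_bigr => i _; rewrite primitiveB// ger0_norm//.
by apply: Rintegral_ge0 => y _.
Qed.

Lemma ae_is_derive_primitive :
  {ae mu, forall t : R, is_derive t (1 : R) primitive (k t)}.
Proof.
have := @FTC1Ny R k (fun y => kintS _ (measurable_itv _))
  (open_integrable_locally openT kint).
apply: filterS; first exact: (ae_filter_ringOfSetsType mu).
move=> t [h1 h2]; split=> //.
by rewrite -derive1E h2.
Qed.

End primitive.

Lemma is_derive_powR1D {R : realType} (a t : R) : 0 < 1 + t ->
  is_derive t 1 (fun s => (1 + s) `^ a) (a * (1 + t) `^ (a - 1)).
Proof.
move=> t0.
have h1 : is_derive t 1 (fun s : R => 1 + s) 1.
  have -> : (fun s : R => 1 + s) = cst 1 + id by [].
  by apply: is_derive_eq; rewrite add0r.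
have h2 := @is_derive1_powR R a (1 + t) t0.
apply: is_derive_eq; first exact: (is_derive1_comp h2 h1).
by rewrite mulr1.
Qed.

(** Continuity at [t], in the form in which the difference quotients of the product rules use it. *)
Lemma derivable_cvg_shift {R : realType} {V : normedModType R} (g : R -> V)
    (t : R) :
  derivable g t 1 -> g (s *: 1 + t) @[s --> 0^'] --> g t.
Proof.
move=> dg.
have : {for t, continuous g}.
  by apply: differentiable_continuous; apply/derivable1_diffP.
move=> cg; apply: (cvg_comp (fun s : R => s *: 1 + t) g) cg.
apply/cvgrPdist_lt => e e0; near=> s.
rewrite [s%:A]mulr1 opprD addrCA subrr addr0 normrN; near: s.
exact: dnbhs0_lt.
Unshelve. all: by end_near. Qed.

(** * Inner products: Cauchy-Schwarz, continuity, product rule *)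

Section inner_product.
Context {R : realType} {H : normedModType R}.
Variable ip : H -> H -> R.
Hypothesis hip : is_inner_product ip.

Lemma ipC x y : ip x y = ip y x. Proof. by case: hip. Qed.

Lemma ip_norm x : ip x x = `|x| ^+ 2. Proof. by case: hip. Qed.

Lemma ipDl x y z : ip (x + y) z = ip x z + ip y z.
Proof. by case: hip => _ /(_ 1 x y z) + _; rewrite scale1r mul1r. Qed.

Lemma ip0l z : ip 0 z = 0.
Proof.
have := ipDl 0 0 z; rewrite addr0 => /esym/eqP.
by rewrite addrC -subr_eq0 addrK => /eqP.
Qed.

Lemma ipZl a x z : ip (a *: x) z = a * ip x z.
Proof. by case: hip => _ /(_ a x 0 z) + _; rewrite addr0 ip0l addr0. Qed.

Lemma ipNl x z : ip (- x) z = - ip x z.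
Proof. by rewrite -scaleN1r ipZl mulN1r. Qed.

Lemma ipBl x y z : ip (x - y) z = ip x z - ip y z.
Proof. by rewrite ipDl ipNl. Qed.

Lemma ipDr x y z : ip z (x + y) = ip z x + ip z y.
Proof. by rewrite !(ipC z) ipDl. Qed.

Lemma ipZr a x z : ip z (a *: x) = a * ip z x.
Proof. by rewrite !(ipC z) ipZl. Qed.

Lemma ipBr x y z : ip z (x - y) = ip z x - ip z y.
Proof. by rewrite !(ipC z) ipBl. Qed.

Lemma ip_cauchy_schwarz x y : `|ip x y| <= `|x| * `|y|.
Proof.
have [->|y0] := eqVneq y 0.
  by rewrite ipC ip0l !normr0 mulr0.
have ny : 0 < `|y| by rewrite normr_gt0.
rewrite -ler_sqr ?nnegrE ?mulr_ge0// real_normK ?num_real//.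
(* This vector is [|y|^2] times the component of [x] orthogonal to [y]. *)
have : 0 <= ip (`|y| ^+ 2 *: x - ip x y *: y) (`|y| ^+ 2 *: x - ip x y *: y).
  by rewrite ip_norm sqr_ge0.
rewrite !ipBl !ipBr !ipZl !ipZr !ip_norm (ipC y x).
set A := ip x y; set n := `|y| in ny *; set m := `|x|.
have -> : n ^+ 2 * (n ^+ 2 * m ^+ 2) - n ^+ 2 * (A * A) -
  (A * (n ^+ 2 * A) - A * (A * n ^+ 2)) = n ^+ 2 * ((m * n) ^+ 2 - A ^+ 2) by ring.
by rewrite pmulr_rge0 ?subr_ge0// exprn_gt0.
Qed.

Lemma ip_polarization x y : ip x y = (`|x + y| ^+ 2 - `|x| ^+ 2 - `|y| ^+ 2) / 2.
Proof. by rewrite -!ip_norm !ipDl !ipDr (ipC y x); field. Qed.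

(** Polarization reduces the continuity of [ip] to that of the norm. *)
Lemma cvg_ip {T : Type} (F : set_system T) {FF : Filter F} (f g : T -> H) (a b : H) :
  f @ F --> a -> g @ F --> b -> ip (f t) (g t) @[t --> F] --> ip a b.
Proof.
move=> fa gb; rewrite ip_polarization.
have sq (u : T -> H) (l : H) : u @ F --> l -> `|u t| ^+ 2 @[t --> F] --> `|l| ^+ 2.
  move=> ul; under eq_cvg do rewrite expr2.
  by rewrite expr2; apply: cvgM; exact: cvg_norm.
under eq_cvg do rewrite ip_polarization.
apply: cvgMl; apply: cvgB; [apply: cvgB|]; apply: sq => //.
exact: cvgD.
Qed.

Lemma is_derive_ip (f g : R -> H) (t : R) (df dg : H) :
  is_derive t 1 f df -> is_derive t 1 g dg ->
  is_derive t 1 (fun s => ip (f s) (g s)) (ip df (g t) + ip (f t) dg).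
Proof.
move=> [df1 df2] [dg1 dg2].
have cg := derivable_cvg_shift g t dg1.
have key : s^-1 *: (ip (f (s *: 1 + t)) (g (s *: 1 + t)) - ip (f t) (g t))
    @[s --> 0^'] --> (ip df (g t) + ip (f t) dg).
  have -> : (fun s : R => s^-1 *: (ip (f (s *: 1 + t)) (g (s *: 1 + t)) - ip (f t) (g t))) =
    (fun s => ip (s^-1 *: (f (s *: 1 + t) - f t)) (g (s *: 1 + t)) +
      ip (f t) (s^-1 *: (g (s *: 1 + t) - g t))).
    apply/funext => s; rewrite ipZl ipZr ipBl ipBr -[_ *: _]/(_ * _); ring.
  apply: cvgD; apply: cvg_ip => //.
  - by rewrite -df2.
  - exact: cvg_cst.
  - by rewrite -dg2.
split; first by apply/cvg_ex; eexists; exact: key.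
by apply: cvg_lim => //; exact: key.
Qed.

Lemma abs_cont_on_ip (a b : R) (f g : R -> H) :
  abs_cont_on a b f -> abs_cont_on a b g ->
  abs_cont_on a b (fun t => ip (f t) (g t)).
Proof.
apply: (@abs_cont_on_bilinear R H H R ip) => *.
- exact: ipBl.
- exact: ipBr.
- exact: ip_cauchy_schwarz.
Qed.

End inner_product.

(** * Convex functions *)

Lemma is_derive_comp_diff {R : realType} {V W : normedModType R} (f : V -> W)
    (x : R -> V) (t : R) (v : V) :
  is_derive t 1 x v -> differentiable f (x t) ->
  is_derive t 1 (fun s => f (x s)) ('d f (x t) v).
Proof.
move=> [dx <-] df.
have dx' : differentiable x t by apply/derivable1_diffP.
have dfx : differentiable (f \o x) t by exact: differentiable_comp.
split; first by apply/derivable1_diffP.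
rewrite (_ : (fun s => f (x s)) = f \o x)//.
by rewrite deriveE// diff_comp// deriveE.
Qed.

Section convex_gradient.
Context {R : realType} {H : normedModType R}.
Variables (ip : H -> H -> R) (Phi : H -> R) (gradPhi : H -> H).
Hypothesis hip : is_inner_product ip.
Hypothesis dPhi : forall u, differentiable Phi u /\
  (forall h, 'd Phi u h = ip (gradPhi u) h).
Hypothesis cPhi : forall (u w : H) (l : R), 0 <= l <= 1 ->
  Phi (l *: u + (1 - l) *: w) <= l * Phi u + (1 - l) * Phi w.

(** By convexity the difference quotient of [Phi] at [u] towards [w] is at most [Phi w - Phi u]; at
    a small step it is within [e] of the directional derivative. *)
Lemma gradient_ineq (u w : H) : Phi u + ip (gradPhi u) (w - u) <= Phi w.
Proof.
apply/ler_addgt0Pr => e e0.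
pose h := w - u.
have [du dE] := dPhi u.
have : derivable Phi u h by exact: diff_derivable.
move=> /cvgrPdist_le/(_ _ e0)[s0 /= s00 s0P].
pose s := Num.min (s0 / 2) 1.
have ss : 0 < s by rewrite /s lt_min; apply/andP; split; lra.
have ss0 : s <= s0 / 2 by rewrite ge_min lexx.
have s1 : s <= 1 by rewrite ge_min lexx orbT.
have sn0 : s != 0 by rewrite gt_eqF.
have := s0P s; rewrite /= sub0r normrN gtr0_norm// => /(_ _ sn0) hs.
have {hs}/(le_trans (ler_norm _)) : `|'D_h Phi u - s^-1 *: (Phi (s *: h + u) - Phi u)| <= e.
  by apply: hs; lra.
rewrite deriveE// dE -[_ *: _]/(_ * _) => hs.
have : Phi (s *: h + u) <= s * Phi w + (1 - s) * Phi u.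
  have -> : s *: h + u = s *: w + (1 - s) *: u.
    by rewrite /h scalerBr scalerBl scale1r -addrA [- _ + u]addrC.
  by apply: cPhi; lra.
move=> hc.
have : s^-1 * (Phi (s *: h + u) - Phi u) <= Phi w - Phi u.
  rewrite mulrC ler_pdivrMr//; lra.
rewrite -/h; lra.
Qed.

Lemma gradient_eq0_min (u : H) : gradPhi u = 0 -> forall w, Phi u <= Phi w.
Proof.
by move=> gu w; have := gradient_ineq u w; rewrite gu ip0l// addr0.
Qed.

(* Apply the gradient inequality at the minimizer [z + (rho / |g|) g] where
   [g] is the gradient at [u]. *)
Lemma gradient_interior_ineq (z : H) (rho : R) : 0 <= rho ->
  (forall y, `|y - z| <= rho -> forall w, Phi y <= Phi w) ->
  forall u, rho * `|gradPhi u| <= ip (gradPhi u) (u - z).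
Proof.
move=> rho0 hz u; set G := gradPhi u.
have [G0|G0] := eqVneq G 0.
  by rewrite G0 normr0 mulr0 ip0l.
have nG : 0 < `|G| by rewrite normr_gt0.
pose y := z + (rho / `|G|) *: G.
have yz : y - z = (rho / `|G|) *: G by rewrite /y addrC addKr.
have hy : Phi y <= Phi u.
  apply: hz; rewrite yz normrZ ger0_norm ?divr_ge0//.
  by rewrite divfK// gt_eqF.
have := gradient_ineq u y; rewrite -/G.
have -> : y - u = (y - z) - (u - z) by rewrite opprB addrA subrK.
rewrite ipBr// yz ipZr// ip_norm// expr2 mulrA divfK ?gt_eqF//.
by move: hy; set a := ip _ _; set b := _ * `|G|; lra.
Qed.

(** The gradient is bounded by some [M] along the compact arc [x]; the gradient inequality, used at
    both ends, makes increments of [Phi (x t)] at most [M] times those of [x]. *)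
Lemma abs_cont_on_convex_comp (x : R -> H) (a b : R) :
  continuous gradPhi -> abs_cont_on a b x ->
  abs_cont_on a b (fun t => Phi (x t)).
Proof.
move=> cg ac.
have cgx : {within `[a, b], continuous (gradPhi \o x)}.
  apply: within_continuous_comp; first by move=> u _; exact: cg.
  exact: abs_cont_on_within_continuous.
have [M MP] := within_continuous_norm_bounded _ _ _ cgx.
apply: (@abs_cont_on_dominated _ _ _ _ a b M x x) => // s t sab tab.
have key s' t' : a <= t' <= b -> Phi (x t') - Phi (x s') <= M * `|x t' - x s'|.
  move=> t'ab; have := gradient_ineq (x t') (x s').
  have : ip (gradPhi (x t')) (x t' - x s') <= M * `|x t' - x s'|.
    apply: (le_trans (ler_norm _)).
    apply: (le_trans (ip_cauchy_schwarz _ hip _ _)).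
    by rewrite ler_wpM2r//; exact: MP.
  rewrite !(ipBr _ hip); lra.
have M0 : 0 <= M by apply: le_trans (MP _ tab).
apply: (@le_trans _ _ (M * `|x t - x s|)); last first.
  by rewrite mulrDr lerDl mulr_ge0.
rewrite ler_norml; apply/andP; split; last exact: key.
by have := key t s sab; rewrite distrC; lra.
Qed.

End convex_gradient.

(** * The Lyapunov function *)

Lemma is_derive_mul {R : realType} (f g : R -> R) (t df dg : R) :
  is_derive t 1 f df -> is_derive t 1 g dg ->
  is_derive t 1 (fun s => f s * g s) (f t * dg + g t * df).
Proof. exact: is_deriveM. Qed.

Lemma is_derive_add {R : realType} {V : normedModType R} (f g : R -> V)
    (t : R) (df dg : V) :
  is_derive t 1 f df -> is_derive t 1 g dg ->
  is_derive t 1 (fun s => f s + g s) (df + dg).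
Proof. exact: is_deriveD. Qed.

Lemma is_derive_const {R : realType} {V : normedModType R} (k : V) (t : R) :
  is_derive t 1 (fun=> k) 0.
Proof. exact: is_derive_cst. Qed.

Lemma is_derive_scale {R : realType} {V : normedModType R} (f : R -> R)
    (g : R -> V) (t df : R) (dg : V) :
  is_derive t 1 f df -> is_derive t 1 g dg ->
  is_derive t 1 (fun s => f s *: g s) (df *: g t + f t *: dg).
Proof.
move=> [df1 df2] [dg1 dg2].
have cg := derivable_cvg_shift g t dg1.
have key : s^-1 *: (f (s *: 1 + t) *: g (s *: 1 + t) - f t *: g t) @[s --> 0^'] -->
    (df *: g t + f t *: dg).
  have -> : (fun s : R => s^-1 *: (f (s *: 1 + t) *: g (s *: 1 + t) - f t *: g t)) =
    (fun s => (s^-1 *: (f (s *: 1 + t) - f t)) *: g (s *: 1 + t) +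
              f t *: (s^-1 *: (g (s *: 1 + t) - g t))).
    apply/funext => s.
    have zE (c a b : R) (G G0 : V) :
        c *: (a *: G - b *: G0) = (c * (a - b)) *: G + b *: (c *: (G - G0)).
      rewrite -scalerA (scalerA b c) (mulrC b c) -(scalerA c b) -scalerDr.
      by congr (_ *: _); rewrite scalerBl scalerBr addrA subrK.
    exact: zE.
  apply: cvgD; apply: cvgZ => //.
  - by rewrite -df2.
  - exact: cvg_cst.
  - by rewrite -dg2.
split; first by apply/cvg_ex; eexists; exact: key.
by apply: cvg_lim => //; exact: key.
Qed.

Section lyapunov.
Context {R : realType} {H : normedModType R}.
Notation mu := (@lebesgue_measure R).
Variables (ip : H -> H -> R) (Phi : H -> R) (gradPhi : H -> H).
Hypothesis hip : is_inner_product ip.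
Hypothesis dPhi : forall u, differentiable Phi u /\
  (forall h, 'd Phi u h = ip (gradPhi u) h).
Hypothesis cPhi : forall (u w : H) (l : R), 0 <= l <= 1 ->
  Phi (l *: u + (1 - l) *: w) <= l * Phi u + (1 - l) * Phi w.
Hypothesis cgrad : continuous gradPhi.
Variables (z : H) (rho : R).
Hypothesis rho0 : 0 < rho.
Hypothesis hz : forall y, `|y - z| <= rho -> forall w, Phi y <= Phi w.
Variables (p p1 p2 gam k : R -> R) (g x v : R -> H) (T0 pmin : R).
Hypothesis pmin0 : 0 < pmin.
Hypothesis p_ge : forall t, T0 <= t -> pmin <= p t.
Hypothesis gamp : forall t, T0 <= t -> gam t * p t = 1.
Hypothesis dp : forall t, T0 <= t -> is_derive t 1 p (p1 t).
Hypothesis dp1 : forall t, T0 <= t -> is_derive t 1 p1 (p2 t).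
Hypothesis p1b : forall t, T0 <= t -> 0 <= p1 t <= 1 / 16.
Hypothesis p2b : forall t, T0 <= t -> p2 t <= 0.
Hypothesis acp : forall T, abs_cont_on T0 T p.
Hypothesis acp1 : forall T, abs_cont_on T0 T p1.
Hypothesis acx : forall T, abs_cont_on T0 T x.
Hypothesis acv : forall T, abs_cont_on T0 T v.
Hypothesis ae_x : {ae mu, forall t : R, T0 <= t -> is_derive t (1 : R) x (v t)}.
Hypothesis ae_v : {ae mu, forall t : R, T0 <= t ->
  is_derive t (1 : R) v (g t - gam t *: v t - gradPhi (x t))}.
Hypothesis k0 : forall t, 0 <= k t.
Hypothesis kE : forall t, T0 <= t -> k t = p t * `|g t|.
Hypothesis kint : mu.-integrable setT (EFin \o k).

(** The weight [1 - p1] makes the terms in [<v, x - z>] cancel in the derivative. The weight [4]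
    makes friction yield [- 4 p |v|^2], which outweighs the [p |v|^2] coming from the cross term. *)
Definition smooth_energy (t : R) : R :=
  4 * (p t * p t) * (ip (v t) (v t) / 2 + (Phi (x t) - Phi z)) +
  p t * ip (v t) (x t - z) + (1 - p1 t) * (ip (x t - z) (x t - z) / 2).

(** The added norm may fail to be differentiable where [v] vanishes, hence the Dini derivatives; it
    supplies a decrease linear in [|v|], which controls the length of the trajectory. *)
Definition energy (t : R) : R := smooth_energy t + rho / 4 * `|p t *: v t|.

Let p_gt0 t : T0 <= t -> 0 < p t.
Proof. by move=> /p_ge; exact: lt_le_trans. Qed.

Let Phiz u : Phi z <= Phi u.
Proof. by apply: hz; rewrite subrr normr0 ltW. Qed.

Let PhiG u : Phi u - Phi z <= ip (gradPhi u) (u - z).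
Proof.
have := gradient_ineq _ _ _ dPhi cPhi u z.
by rewrite !(ipBr _ hip); lra.
Qed.

Let rhoG u : rho * `|gradPhi u| <= ip (gradPhi u) (u - z).
Proof. exact: (gradient_interior_ineq _ _ _ hip dPhi cPhi _ _ (ltW rho0) hz). Qed.

Lemma is_derive_smooth_energy (t : R) : T0 <= t ->
  is_derive t 1 x (v t) ->
  is_derive t 1 v (g t - gam t *: v t - gradPhi (x t)) ->
  is_derive t 1 smooth_energy
    (8 * p t * p1 t * (ip (v t) (v t) / 2 + (Phi (x t) - Phi z)) +
     4 * (p t * p t) * ip (g t) (v t) - 3 * p t * ip (v t) (v t) +
     p t * ip (g t) (x t - z) - p t * ip (gradPhi (x t)) (x t - z) -
     p2 t * (ip (x t - z) (x t - z) / 2)).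
Proof.
move=> Tt dx dv.
have dxz : is_derive t 1 (fun s => x s - z) (v t).
  by rewrite -[v t]addr0; apply: is_derive_add => //; exact: is_derive_const.
have dPx : is_derive t 1 (fun s => Phi (x s)) (ip (gradPhi (x t)) (v t)).
  by have [d1 d2] := dPhi (x t); rewrite -d2; apply: is_derive_comp_diff.
have dvv := is_derive_ip _ hip _ _ _ _ _ dv dv.
have dvx := is_derive_ip _ hip _ _ _ _ _ dv dxz.
have dxx := is_derive_ip _ hip _ _ _ _ _ dxz dxz.
have dpt := dp _ Tt; have dp1t := dp1 _ Tt.
have dE := is_derive_add _ _ _ _ _
  (is_derive_mul _ _ _ _ _ dvv (@is_derive_const R R 2^-1 t))
  (is_derive_add _ _ _ _ _ dPx (@is_derive_const R R (- Phi z) t)).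
have dpp := is_derive_mul _ _ _ _ _ (@is_derive_const R R 4 t)
  (is_derive_mul _ _ _ _ _ dpt dpt).
have d1p : is_derive t 1 (fun s => 1 - p1 s) (- p2 t).
  by rewrite -[- p2 t]add0r; apply: is_derive_add.
have dh := is_derive_mul _ _ _ _ _ d1p
  (is_derive_mul _ _ _ _ _ dxx (@is_derive_const R R 2^-1 t)).
have dL := is_derive_add _ _ _ _ _ (is_derive_add _ _ _ _ _
  (is_derive_mul _ _ _ _ _ dpp dE) (is_derive_mul _ _ _ _ _ dpt dvx)) dh.
apply: (is_derive_eq dL).
rewrite !(ipBl _ hip (_ - _)) !(ipBl _ hip (g t)) !(ipBr _ hip _ (gradPhi (x t))).
rewrite !(ipBr _ hip (g t)) !(ipZl _ hip) !(ipZr _ hip).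
rewrite (ipC _ hip (v t) (g t)) (ipC _ hip (v t) (gradPhi (x t))) (ipC _ hip (x t - z) (v t)).
have gE := gamp _ Tt.
set a := ip (v t) (v t); set b := ip (v t) (x t - z).
set r2 := ip (x t - z) (x t - z); set gv := ip (g t) (v t).
set gx := ip (g t) (x t - z); set Gx := ip (gradPhi (x t)) (x t - z).
set Gv := ip (gradPhi (x t)) (v t); set phi := Phi (x t) - Phi z.
apply/eqP; rewrite -subr_eq0; apply/eqP.
(* Once expanded, the two sides differ by a multiple of [gam t * p t - 1]. *)
transitivity ((gam t * p t - 1) * (- 4 * p t * a - b)); last by rewrite gE subrr mul0r.
by field.
Qed.

(** Half of [p <grad Phi (x), x - z>] pays for the potential term in [p1], by convexity. The other
    half is at least [(rho / 2) p |grad Phi (x)|]: it pays for the gradient in the derivative of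
    [(rho / 4) |p v|] and leaves as much again. *)
Lemma dini_le_energy (t : R) : T0 <= t ->
  is_derive t 1 x (v t) ->
  is_derive t 1 v (g t - gam t *: v t - gradPhi (x t)) ->
  dini_le energy t (- (rho / 8) * `|v t| - rho / 4 * (p t * `|gradPhi (x t)|) +
    k t * (4 * (p t * `|v t|) + `|x t - z| + rho / 4) -
    p2 t * (`|x t - z| ^+ 2 / 2)).
Proof.
move=> Tt dx dv.
have pt := p_gt0 _ Tt; have gE := gamp _ Tt; have /andP[p10 p11] := p1b _ Tt.
have dL := dini_le_is_derive _ _ _ (is_derive_smooth_energy _ Tt dx dv).
(* As [gam p = 1], the part [p1 v - v] is a multiple of [p v], the shape that [dini_le_norm]
   expects. *)
have dpv : is_derive t 1 (fun s => p s *: v s)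
    (- ((1 - p1 t) * gam t) *: (p t *: v t) + p t *: (g t - gradPhi (x t))).
  apply: is_derive_eq; first exact: (is_derive_scale _ _ _ _ _ (dp _ Tt) dv).
  rewrite scalerA mulNr -mulrA gE mulr1 opprB scalerBl scale1r.
  rewrite [X in p t *: X]addrAC [p t *: (_ - gam t *: _)]scalerBr scalerA.
  by rewrite [p t * _]mulrC gE scale1r addrA addrAC.
have := dini_le_norm _ _ _ _ dpv.
rewrite normrZ (gtr0_norm pt) [p t * `|v t|]mulrC mulrA !mulNr => dn.
have r4 : 0 < rho / 4 by rewrite divr_gt0.
have := dini_leD _ _ _ _ _ dL (dini_leZ _ _ _ _ r4 dn).
apply: dini_le_trans; rewrite kE//.
have := rhoG (x t); have := PhiG (x t); have := Phiz (x t).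
have := ip_cauchy_schwarz _ hip (g t) (v t) => /(le_trans (ler_norm _)).
have := ip_cauchy_schwarz _ hip (g t) (x t - z) => /(le_trans (ler_norm _)).
have := ler_normB (g t) (gradPhi (x t)).
rewrite normrZ (gtr0_norm pt) !(ip_norm _ hip).
have := normr_ge0 (v t); have := normr_ge0 (g t); have := normr_ge0 (gradPhi (x t)).
have := normr_ge0 (x t - z).
have -> : (1 - p1 t) * gam t * (`|v t| * p t) = (1 - p1 t) * `|v t|.
  by rewrite -[RHS]mulr1 -gE; ring.
set V := `|v t|; set r := `|x t - z|; set GG := `|gradPhi (x t)|; set gg := `|g t|.
set gv := ip (g t) (v t); set gx := ip (g t) (x t - z).
set Gx := ip (gradPhi (x t)) (x t - z); set gG := `|g t - gradPhi (x t)|.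
set P := Phi (x t); set P0 := Phi z.
move=> r0 GG0 gg0 V0 hgG hgx hgv hP0 hP hG.
pose q := p t; pose q1 := p1 t.
(* Here [p1 <= 1 / 16] is used: [8 * p1 <= 1 / 2]. *)
have e1 : 8 * q * q1 * (V ^+ 2 / 2 + (P - P0)) <= q / 2 * (V ^+ 2 / 2 + (P - P0)).
  rewrite ler_wpM2r//; first by rewrite addr_ge0 ?subr_ge0// divr_ge0 ?sqr_ge0.
  rewrite [8 * q]mulrC -mulrA ler_pM2l//; rewrite /q1; lra.
have e2 : q * q * gv <= q * q * (gg * V) by rewrite ler_pM2l// mulr_gt0.
have e3 : q * gx <= q * (gg * r) by rewrite ler_pM2l.
have e4 : q * ((P - P0) / 2 + rho * GG / 2) <= q * Gx by rewrite ler_pM2l//; lra.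
have e5 : rho / 4 * (q * gG) <= rho / 4 * (q * (gg + GG)).
  by rewrite ler_pM2l// ler_pM2l.
have e6 : rho / 4 * ((1 / 2) * V) <= rho / 4 * ((1 - q1) * V).
  by rewrite ler_pM2l// ler_wpM2r// /q1; lra.
have e7 : 0 <= q * V ^+ 2 by rewrite mulr_ge0 ?sqr_ge0// ltW.
rewrite -/q -/q1.
lra.
Qed.

Lemma energy_ge (t : R) : T0 <= t ->
  (p t * `|v t|) ^+ 2 / 2 + `|x t - z| ^+ 2 / 4 <= energy t.
Proof.
move=> Tt; rewrite /energy /smooth_energy.
have pt := p_gt0 _ Tt; have /andP[p10 p11] := p1b _ Tt.
have := ip_cauchy_schwarz _ hip (v t) (x t - z) => h.
have {h} : - (`|v t| * `|x t - z|) <= ip (v t) (x t - z).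
  by move: h; rewrite ler_norml => /andP[].
rewrite !(ip_norm _ hip).
have := Phiz (x t); have := normr_ge0 (p t *: v t).
set V := `|v t|; set r := `|x t - z|; set b := ip _ _; set W := `|_ *: _|.
move=> W0 P0 hb.
have e1 : p t * (- (V * r)) <= p t * b by rewrite ler_pM2l.
have e2 : 0 <= 4 * (p t * p t) * (Phi (x t) - Phi z).
  by rewrite mulr_ge0 ?subr_ge0// mulr_ge0// mulr_ge0// ltW.
have e3 : 0 <= rho / 4 * W by rewrite mulr_ge0// divr_ge0// ltW.
have e4 : (15 / 16) * (r ^+ 2 / 2) <= (1 - p1 t) * (r ^+ 2 / 2).
  by rewrite ler_wpM2r ?divr_ge0 ?sqr_ge0//; lra.
have e5 : 0 <= (p t * V - r / 3) ^+ 2 by exact: sqr_ge0.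
have e6 : 0 <= r ^+ 2 by exact: sqr_ge0.
have e7 : (p t * V - r / 3) ^+ 2 =
    (p t * V) ^+ 2 - 2 / 3 * (p t * (V * r)) + r ^+ 2 / 9 by field.
have e8 : 4 * (p t * p t) * (V ^+ 2 / 2) = 2 * (p t * V) ^+ 2 by field.
rewrite mulrDr.
lra.
Qed.

Lemma abs_cont_on_energy (T : R) : abs_cont_on T0 T energy.
Proof.
have acxz : abs_cont_on T0 T (fun s => x s - z).
  by apply: abs_cont_onD; [exact: acx|exact: abs_cont_on_cst].
have acc c : abs_cont_on T0 T (fun=> c : R) by exact: abs_cont_on_cst.
have acP : abs_cont_on T0 T (fun s => Phi (x s)).
  exact: (abs_cont_on_convex_comp _ _ _ hip dPhi cPhi _ _ _ cgrad (acx T)).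
have acpT := acp T; have acp1T := acp1 T; have acvT := acv T.
rewrite /energy /smooth_energy.
apply: abs_cont_onD; first apply: abs_cont_onD; first apply: abs_cont_onD.
- apply: abs_cont_onM.
    by apply: abs_cont_onM => //; exact: abs_cont_onM.
  apply: abs_cont_onD.
    by apply: abs_cont_onM => //; exact: abs_cont_on_ip.
  by apply: abs_cont_onD.
- by apply: abs_cont_onM => //; exact: abs_cont_on_ip.
- apply: abs_cont_onM.
    apply: abs_cont_onD => //.
    have -> : (fun t => - p1 t) = (fun t => -1 * p1 t) by apply/funext => t; rewrite mulN1r.
    exact: abs_cont_onM.
  by apply: abs_cont_onM => //; exact: abs_cont_on_ip.
- apply: abs_cont_onM => //; apply: abs_cont_on_norm; exact: abs_cont_onZ.
Qed.

(** * Descent of the corrected energy and its consequences *)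

Let B := primitive k.

(* If [energy <= m ^+ 2] then [p |v|] and [|x - z|] are at most [2 * m]: the
   correction compensates the terms in [p |g|] and in [p''] of [dini_le_energy]. *)
Definition corrected_energy (m t : R) : R :=
  energy t + (- (10 * m + rho / 4) * B t + 2 * m ^+ 2 * p1 t).

(** The distance [|x - y|] grows at speed at most [|v|], which the term in [|v|] of [dini_le_energy]
    pays for; the gradient term pays for [kappa t]. With [y = x a] this bounds displacements. *)
Lemma corrected_energy_descent (m a b kappa : R) (y : H) :
  T0 <= a -> a <= b -> 0 <= m ->
  (forall t, a <= t <= b -> energy t <= m ^+ 2) ->
  (forall t, a <= t <= b -> kappa <= rho / 4 * (p t * `|gradPhi (x t)|)) ->
  corrected_energy m b + rho / 8 * `|x b - y| + kappa * (b - a) <=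
  corrected_energy m a + rho / 8 * `|x a - y|.
Proof.
move=> Ta ab m0 hm hk.
pose f t := corrected_energy m t + (rho / 8 * `|x t - y| + kappa * t).
suff : f b <= f a by rewrite /f; lra.
have r8 : 0 < rho / 8 by rewrite divr_gt0.
apply: abs_cont_dini_le => //.
  apply: (@abs_cont_onS _ _ T0 b) => //.
  have acc c : abs_cont_on T0 b (fun=> c : R) by exact: abs_cont_on_cst.
  apply: abs_cont_onD; first apply: abs_cont_onD.
  - exact: abs_cont_on_energy.
  - apply: abs_cont_onD; first by apply: abs_cont_onM => //; exact: abs_cont_on_primitive.
    by apply: abs_cont_onM => //; exact: acp1.
  - apply: abs_cont_onD.
      apply: abs_cont_onM => //; apply: abs_cont_on_norm.
      by apply: abs_cont_onD; [exact: acx|exact: abs_cont_on_cst].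
    apply: abs_cont_onM => //.
    by apply: (@abs_cont_on_lip _ _ _ _ 1) => s t _ _; rewrite mul1r.
have ae_B := ae_is_derive_primitive _ kint.
have FF : Filter (almost_everywhere mu) := ae_filter_ringOfSetsType mu.
have := @filterI _ _ FF _ _ (@filterI _ _ FF _ _ ae_x ae_v) ae_B.
apply: (@filterS _ _ FF) => t [[dx dv] dB] /andP[at_ tb].
have Tt : T0 <= t by exact: le_trans at_.
have tab : a <= t <= b by rewrite at_ ltW.
have {}dx := dx Tt; have {}dv := dv Tt.
have dxy : is_derive t 1 (fun s => x s - y) (- 0 *: (x t - y) + v t).
  rewrite oppr0 scale0r add0r -[v t]addr0.
  by apply: is_derive_add => //; exact: is_derive_const.
have dn := dini_le_norm _ _ _ _ dxy.
rewrite oppr0 mul0r add0r in dn.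
have dC := dini_le_is_derive _ _ _ (is_derive_add _ _ _ _ _
  (is_derive_mul _ _ _ _ _ (@is_derive_const R R (- (10 * m + rho / 4)) t) dB)
  (is_derive_mul _ _ _ _ _ (@is_derive_const R R (2 * m ^+ 2) t) (dp1 _ Tt))).
have dk := dini_le_is_derive _ _ _
  (is_derive_mul _ _ _ _ _ (@is_derive_const R R kappa t) (@is_derive_id R R t 1)).
have := dini_leD _ _ _ _ _
  (dini_leD _ _ _ _ _ (dini_le_energy _ Tt dx dv) dC)
  (dini_leD _ _ _ _ _ (dini_leZ _ _ _ _ r8 dn) dk).
apply: dini_le_trans.
have hE := le_trans (energy_ge _ Tt) (hm _ tab).
have hkt := hk _ tab; have hp2 := p2b _ Tt; have k0t := k0 t.
have pv0 : 0 <= p t * `|v t| by rewrite mulr_ge0// ltW// p_gt0.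
have r0 := normr_ge0 (x t - z).
have sqr_le (u : R) : 0 <= u -> u ^+ 2 <= (2 * m) ^+ 2 -> u <= 2 * m.
  by move=> u0; rewrite ler_sqr// nnegrE mulr_ge0.
have h2m : (2 * m) ^+ 2 = 4 * m ^+ 2 by rewrite exprMn; congr (_ * _); rewrite expr2; lra.
have hpv : p t * `|v t| <= 2 * m.
  apply: sqr_le => //; rewrite h2m.
  by have := sqr_ge0 `|x t - z|; have := sqr_ge0 m; lra.
have hr : `|x t - z| <= 2 * m.
  apply: sqr_le => //; rewrite h2m.
  by have := sqr_ge0 (p t * `|v t|); lra.
(* [10 m] is [4 (2 m) + 2 m]. *)
have e1 : k t * (4 * (p t * `|v t|) + `|x t - z| + rho / 4) <= k t * (10 * m + rho / 4).
  by rewrite ler_wpM2l//; lra.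
have e2 : - p2 t * (`|x t - z| ^+ 2 / 2) <= - p2 t * (2 * m ^+ 2).
  rewrite ler_wpM2l//; first by rewrite oppr_ge0.
  by have := sqr_ge0 (p t * `|v t|); lra.
rewrite !mulr0 !addr0 mulr1.
set X := k t * _ in e1 *; lra.
Qed.

Let K := (\int[mu]_y k y)%R.

Let B_le t : B t <= K. Proof. exact: primitive_le_total. Qed.

Let B_ge0 t : 0 <= B t. Proof. exact: primitive_ge0. Qed.

Let coef_ge0 (m : R) : 0 <= m -> 0 <= 10 * m + rho / 4.
Proof. by have := rho0; lra. Qed.

(** Let [m ^+ 2] be the maximum of the energy on [[T0, T]], reached at [c]. Descent from [T0] to [c]
    gives [m^2 <= energy T0 + (10 m + rho / 4) K + m^2 / 8], which bounds [m] independently of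
    [T]. *)
Lemma energy_bounded : exists2 m : R, 0 <= m & forall t, T0 <= t -> energy t <= m ^+ 2.
Proof.
pose Q := 2 * (energy T0 + 100 * K ^+ 2 + rho / 4 * K).
have K0 : 0 <= K := le_trans (B_ge0 0) (B_le 0).
have E0 t : T0 <= t -> 0 <= energy t.
  move=> Tt; apply: le_trans (energy_ge _ Tt).
  by rewrite addr_ge0// divr_ge0 ?sqr_ge0.
have Q0 : 0 <= Q.
  have : 0 <= rho / 4 * K by rewrite mulr_ge0// divr_ge0// ltW.
  by have := E0 _ (lexx T0); have := sqr_ge0 K; rewrite /Q; lra.
(* The energy stays below [Q], and [Q <= (1 + Q)^2] puts the bound in the form of a square. *)
exists (1 + Q); first by rewrite addr_ge0.
move=> T TT.
have [c cT cmax] := EVT_max TT (abs_cont_on_within_continuous _ _ _ (abs_cont_on_energy T)).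
move: cT; rewrite in_itv/= => /andP[Tc cT].
pose m : R := Num.sqrt (energy c).
have m0 : 0 <= m by exact: sqrtr_ge0.
have mE : m ^+ 2 = energy c by rewrite sqr_sqrtr// E0.
have := @corrected_energy_descent m T0 c 0 (x T0) (lexx _) Tc m0.
rewrite subrr normr0 mul0r mulr0 !addr0 => /(_ _ _) hd.
have {hd} : corrected_energy m c + rho / 8 * `|x c - x T0| <= corrected_energy m T0.
  apply: hd => t /andP[t1 t2].
    by rewrite mE; apply: cmax; rewrite in_itv/= t1 (le_trans t2).
  by rewrite mulr_ge0 ?divr_ge0 ?(ltW rho0)// mulr_ge0// ltW// p_gt0.
have : 0 <= rho / 8 * `|x c - x T0| by rewrite mulr_ge0// divr_ge0// ltW.
rewrite /corrected_energy -mE => h1 h2.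
have h3 : energy T <= m ^+ 2.
  by rewrite mE; apply: cmax; rewrite in_itv/= TT lexx.
have /andP[q0 q1] := p1b _ (lexx T0); have /andP[q2 q3] := p1b _ Tc.
have e1 : (10 * m + rho / 4) * (B c - B T0) <= (10 * m + rho / 4) * K.
  have := B_ge0 T0; have := B_le c => hc h0.
  by apply: (ler_wpM2l (coef_ge0 m m0)); lra.
have e2 : 2 * m ^+ 2 * (p1 T0 - p1 c) <= 2 * m ^+ 2 * (1 / 16).
  by rewrite ler_wpM2l// ?mulr_ge0 ?sqr_ge0//; lra.
(* Absorbs the linear term: [10 m K <= m^2 / 4 + 100 K^2]. *)
have e3 : 0 <= (m / 2 - 10 * K) ^+ 2 by exact: sqr_ge0.
have e4 : (m / 2 - 10 * K) ^+ 2 = m ^+ 2 / 4 - 10 * m * K + 100 * K ^+ 2 by field.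
have e5 : m ^+ 2 <= Q by move: (Q0); rewrite /Q; lra.
have e6 : Q <= (1 + Q) ^+ 2.
  have -> : (1 + Q) ^+ 2 = 1 + 2 * Q + Q ^+ 2 by ring.
  by have := sqr_ge0 Q; lra.
lra.
Qed.

Lemma corrected_energy_ge (m t : R) : T0 <= t -> 0 <= m ->
  - (10 * m + rho / 4) * K <= corrected_energy m t.
Proof.
move=> Tt m0; rewrite /corrected_energy.
have E0 : 0 <= energy t.
  by apply: le_trans (energy_ge _ Tt); rewrite addr_ge0// divr_ge0 ?sqr_ge0.
have /andP[q2 q3] := p1b _ Tt.
have e1 : (10 * m + rho / 4) * B t <= (10 * m + rho / 4) * K.
  exact: (ler_wpM2l (coef_ge0 m m0) (B_le t)).
have e2 : 0 <= 2 * m ^+ 2 * p1 t by rewrite !mulr_ge0// sqr_ge0.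
lra.
Qed.

(** The corrected energy is bounded below. From a time [T] where it is within [(rho / 8) e] of its
    infimum, the descent leaves room for a displacement of at most [e]. *)
Lemma trajectory_cauchy (e : R) : 0 < e ->
  exists2 T, T0 <= T & forall s, T <= s -> `|x s - x T| <= e.
Proof.
move=> e0; have [m m0 hm] := energy_bounded.
pose A := [set corrected_energy m t | t in [set t | T0 <= t]].
have hA : has_inf A.
  split; first by exists (corrected_energy m T0), T0 => //=.
  exists (- (10 * m + rho / 4) * K) => _ [t /= Tt <-].
  exact: corrected_energy_ge.
have r8 : 0 < rho / 8 by rewrite divr_gt0.
have [_ [T /= TT <-] hT] := inf_adherent (mulr_gt0 r8 e0) hA.
exists T => // s Ts; rewrite -(ler_pM2l r8).
have := @corrected_energy_descent m T s 0 (x T) TT Ts m0.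
rewrite subrr normr0 mul0r mulr0 !addr0 => /(_ _ _) hd.
have {hd} : corrected_energy m s + rho / 8 * `|x s - x T| <= corrected_energy m T.
  apply: hd => t /andP[t1 t2]; first by apply: hm; exact: le_trans t1.
  rewrite mulr_ge0 ?divr_ge0 ?(ltW rho0)// mulr_ge0// ltW// p_gt0//.
  exact: le_trans t1.
have : inf A <= corrected_energy m s.
  by apply: ge_inf; [exact: hA.2|exists s => //=; exact: le_trans Ts].
lra.
Qed.

(** Otherwise [|grad Phi (x t)|] is eventually at least half of its positive limit, and the
    corrected energy falls at a rate [kappa > 0], below its lower bound. *)
Lemma limit_gradient_eq0 (xs : H) : x t @[t --> +oo] --> xs -> gradPhi xs = 0.
Proof.
move=> hx; apply/eqP; apply: contrapT => /negP G0.
have nG : 0 < `|gradPhi xs| by rewrite normr_gt0.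
have [m m0 hm] := energy_bounded.
have hG : gradPhi (x t) @[t --> +oo] --> gradPhi xs.
  by apply: cvg_comp hx _; exact: cgrad.
have e0 : 0 < `|gradPhi xs| / 2 by rewrite divr_gt0.
move/cvgrPdist_le : hG => /(_ _ e0) [A [_ AP]].
(* [A + 1], because the neighbourhood of [+oo] only contains the times strictly after [A]. *)
pose a := Num.max T0 (A + 1).
have Ta : T0 <= a by rewrite le_max lexx.
have Aa : A + 1 <= a by rewrite le_max lexx orbT.
have hGa t : a <= t -> `|gradPhi xs| / 2 <= `|gradPhi (x t)|.
  move=> at_; have /= := AP t => /(_ _) h.
  have := ler_normB (gradPhi xs) (gradPhi xs - gradPhi (x t)).
  rewrite opprB addrC subrK.
  have : `|gradPhi xs - gradPhi (x t)| <= `|gradPhi xs| / 2 by apply: h; lra.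
  have := lerB_dist (gradPhi xs) (gradPhi (x t)).
  lra.
pose kappa := rho / 4 * (pmin * (`|gradPhi xs| / 2)).
have kp : 0 < kappa by rewrite !mulr_gt0 ?invr_gt0.
pose D := corrected_energy m a + (10 * m + rho / 4) * K.
have D0 : 0 <= D by have := corrected_energy_ge m a Ta m0; rewrite /D; lra.
(* Long enough for a loss of [D + 1], where only [D] is available. *)
pose b := a + (D + 1) / kappa.
have ab : a <= b by rewrite lerDl divr_ge0 ?(ltW kp)// addr_ge0.
have := @corrected_energy_descent m a b kappa (x a) Ta ab m0.
rewrite subrr normr0 mulr0 addr0 => /(_ _ _) hd.
have {hd} : corrected_energy m b + rho / 8 * `|x b - x a| + kappa * (b - a) <=
    corrected_energy m a.
  apply: hd => t /andP[t1 t2]; first by apply: hm; exact: le_trans t1.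
  rewrite ler_pM2l ?divr_gt0//; apply: ler_pM => //; first exact: ltW.
  - by apply: p_ge; exact: le_trans t1.
  - exact: hGa.
have -> : kappa * (b - a) = D + 1.
  by rewrite /b addrC addKr mulrC divfK// gt_eqF.
have : 0 <= rho / 8 * `|x b - x a| by rewrite mulr_ge0// divr_ge0// ltW.
have := corrected_energy_ge m b (le_trans Ta ab) m0.
rewrite /D; lra.
Qed.

End lyapunov.

(** * Convergence of the trajectory *)

Lemma is_derive_lipschitz {R : realType} (f df : R -> R) (a C : R) :
  (forall t, a <= t -> is_derive t 1 f (df t)) ->
  (forall t, a <= t -> `|df t| <= C) ->
  forall T, abs_cont_on a T f.
Proof.
move=> fdf dfC T; apply: (@abs_cont_on_lip _ _ _ _ C) => s t.
wlog st : s t / s <= t.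
  move=> h sab tab; have [st|ts] := leP s t; first exact: h.
  by rewrite distrC [X in C * X]distrC; apply: h => //; exact: ltW.
move=> /andP[as_ _] _.
have [||c cst ->] := @MVT_segment R f df s t st.
- by move=> y; rewrite in_itv/= => /andP[sy _]; apply: fdf; lra.
- apply: derivable_within_continuous => y; rewrite in_itv/= => /andP[sy _].
  by have [] := fdf y (le_trans as_ sy).
rewrite normrM ler_wpM2r//; apply: dfC; apply: (le_trans as_).
by move: cst; rewrite in_itv/= => /andP[].
Qed.

Lemma powR_small {R : realType} (a eta : R) : a < 0 -> 0 < eta ->
  exists2 T, 1 <= T & forall t, T <= t -> (1 + t) `^ a <= eta.
Proof.
move=> a0 e0.
(* The power is the solution [y] of [y ^ a = eta]; the leading [1] ensures [1 <= T]. *)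
pose T := 1 + eta^-1 `^ (- a)^-1.
have T0 : 0 <= eta^-1 `^ (- a)^-1 by exact: powR_ge0.
exists T; first by rewrite /T lerDl.
move=> t Tt.
have t0 : 0 < 1 + t by rewrite /T in Tt; lra.
rewrite -[a]opprK powRN -[eta]invrK lef_pV2 ?posrE ?invr_gt0 ?powR_gt0//.
rewrite [leLHS](_ : _ = (eta^-1 `^ (- a)^-1) `^ (- a)); last first.
  by rewrite -powRrM mulVf ?oppr_eq0 ?lt_eqF// powRr1// invr_ge0 ltW.
apply: ge0_ler_powR; rewrite ?nnegrE//; first lra.
  exact: ltW.
rewrite /T in Tt; lra.
Qed.

Lemma cvg_pinfty_of_cauchy {R : realType} {H : completeNormedModType R}
    (x : R -> H) :
  (forall e : R, 0 < e -> exists T, forall s, T <= s -> `|x s - x T| <= e) ->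
  exists xs : H, x t @[t --> +oo] --> xs.
Proof.
move=> hx; suff /cvg_ex : cvg (x t @[t --> +oo]) by [].
apply: cauchy_cvg; apply: cauchy_exP => e e0.
have [T hT] := hx (e / 2) ltac:(by rewrite divr_gt0).
exists (x T); rewrite /fmap/=.
exists T; split; first exact: num_real.
move=> s Ts; rewrite /= -ball_normE /= distrC.
by apply: le_lt_trans (hT s (ltW Ts)) _; lra.
Qed.

Theorem theorem3 (R : realType) (H : completeNormedModType R)
  (ip : H -> H -> R) (Phi : H -> R) (gradPhi : H -> H)
  (c alpha : R) (g x v : R -> H) :
  is_inner_product ip ->
  (forall u, differentiable Phi u /\ (forall h, 'd Phi u h = ip (gradPhi u) h)) ->
  continuous gradPhi ->
  (forall (u w : H) (l : R), 0 <= l <= 1 ->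
     Phi (l *: u + (1 - l) *: w) <= l * Phi u + (1 - l) * Phi w) ->
  [set u | forall w, Phi u <= Phi w] !=set0 ->
  0 < c -> 0 <= alpha < 1 ->
  measurable_fun (`[0%R, +oo[%classic : set R) (fun t => `|g t|) ->
  (\int[@lebesgue_measure R]_(t in (`[0%R, +oo[%classic : set R)) (`|g t|)%:E < +oo)%E ->
  W21loc x v ->
  {ae (@lebesgue_measure R), forall t : R, 0 < t ->
     derivable v t 1 /\
     'D_1 v t + (c / (1 + t) `^ alpha) *: v t + gradPhi (x t) = g t} ->
  (\int[@lebesgue_measure R]_(t in (`[0%R, +oo[%classic : set R)) ((1 + t) `^ alpha * `|g t|)%:E
     < +oo)%E ->
  interior [set u | forall w, Phi u <= Phi w] !=set0 ->
  exists2 xs : H, (forall w, Phi xs <= Phi w) & x t @[t --> +oo] --> xs.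
Proof.
move=> hip dPhi cgrad cPhi _ c0 /andP[al0 al1] mg _ [acx acv ae_x] ae_v gint [z].
move=> /nbhs_ballP[r /= r0 hr].
(* Halving puts the closed ball of radius [rho] inside the open ball of radius [r]. *)
pose rho := r / 2.
have rho0 : 0 < rho by rewrite divr_gt0.
have hz y : `|y - z| <= rho -> forall w, Phi y <= Phi w.
  move=> yz; apply: hr; rewrite -ball_normE /= distrC.
  by apply: le_lt_trans yz _; rewrite /rho; lra.
pose p t : R := c^-1 * (1 + t) `^ alpha.
pose p1 t : R := c^-1 * (alpha * (1 + t) `^ (alpha - 1)).
pose p2 t : R := c^-1 * (alpha * ((alpha - 1) * (1 + t) `^ (alpha - 1 - 1))).
pose gam t : R := c / (1 + t) `^ alpha.
(* Extended by [0] to negative times, so as to be integrable on the whole line. *)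
pose k := (fun t => c^-1 * ((1 + t) `^ alpha * `|g t|)) \_ (`[0%R, +oo[%classic : set R).
(* From [T0] on, [p1 = (alpha / c) (1 + t)^(alpha - 1)] is at most [1 / 16]. *)
have [T0 T01 hT0] : exists2 T, 1 <= T & forall t, T <= t -> (1 + t) `^ (alpha - 1) <= c / 16.
  by apply: powR_small; lra.
have ci0 : 0 < c^-1 by rewrite invr_gt0.
have wpos a t : T0 <= t -> 0 < (1 + t) `^ a by move=> Tt; rewrite powR_gt0//; lra.
have wle1 a t : T0 <= t -> a <= 0 -> (1 + t) `^ a <= 1.
  by move=> Tt a0; rewrite -[leRHS](powRr0 (1 + t)); apply: ler_powR => //; lra.
have dw a t : T0 <= t -> is_derive t 1 (fun s : R => (1 + s) `^ a) (a * (1 + t) `^ (a - 1)).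
  by move=> Tt; apply: is_derive_powR1D; lra.
have dmulc (b : R) (f : R -> R) (t df : R) : is_derive t 1 f df ->
    is_derive t 1 (fun s => b * f s) (b * df).
  move=> hf; apply: (is_derive_eq (is_derive_mul _ _ _ _ _ (@is_derive_const R R b t) hf)).
  by rewrite mulr0 addr0.
have dp t : T0 <= t -> is_derive t 1 p (p1 t) by move=> Tt; apply: dmulc; exact: dw.
have dp1 t : T0 <= t -> is_derive t 1 p1 (p2 t).
  by move=> Tt; exact: (dmulc _ _ _ _ (dmulc _ _ _ _ (dw _ _ Tt))).
have p_ge t : T0 <= t -> c^-1 <= p t.
  move=> Tt; rewrite /p -[leLHS]mulr1 ler_pM2l//.
  by rewrite -[leLHS](powRr0 (1 + t)); apply: ler_powR => //; lra.
have gamp t : T0 <= t -> gam t * p t = 1.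
  move=> Tt; rewrite /gam /p; field.
  by rewrite !gt_eqF// wpos.
have p1b t : T0 <= t -> 0 <= p1 t <= 1 / 16.
  move=> Tt; have h := hT0 _ Tt; have h0 := wpos (alpha - 1) _ Tt.
  apply/andP; split; first by rewrite !mulr_ge0// ltW.
  rewrite /p1 mulrC ler_pdivrMr//.
  apply: (@le_trans _ _ (1 * (1 + t) `^ (alpha - 1))); last lra.
  by rewrite ler_pM2r//; lra.
have p2b t : T0 <= t -> p2 t <= 0.
  move=> Tt; have h0 := wpos (alpha - 1 - 1) _ Tt.
  rewrite /p2 pmulr_rle0//; apply: mulr_ge0_le0 => //.
  by rewrite mulr_le0_ge0//; [lra|exact: ltW].
have acp : forall T, abs_cont_on T0 T p.
  apply: (@is_derive_lipschitz _ _ _ _ (c^-1 * alpha) dp) => t Tt.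
  have h0 := wpos (alpha - 1) _ Tt.
  rewrite ger0_norm; last by rewrite !mulr_ge0// ltW.
  rewrite /p1 ler_pM2l// ler_piMr//; apply: wle1 => //; lra.
have acp1 : forall T, abs_cont_on T0 T p1.
  apply: (@is_derive_lipschitz _ _ _ _ (c^-1 * alpha * (1 - alpha)) dp1) => t Tt.
  have h0 := wpos (alpha - 1 - 1) _ Tt.
  rewrite ler0_norm ?p2b// /p2.
  have -> : - (c^-1 * (alpha * ((alpha - 1) * (1 + t) `^ (alpha - 1 - 1)))) =
    c^-1 * alpha * (1 - alpha) * (1 + t) `^ (alpha - 1 - 1) by ring.
  rewrite ler_piMr//; first by rewrite !mulr_ge0//; lra.
  apply: wle1 => //; lra.
have acx' T : abs_cont_on T0 T x.
  have T1 : 0 < `|T| + 1 by rewrite ltr_wpDl.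
  apply: abs_cont_onS (acx _ T1); first lra.
  by have := ler_norm T; lra.
have acv' T : abs_cont_on T0 T v.
  have T1 : 0 < `|T| + 1 by rewrite ltr_wpDl.
  apply: abs_cont_onS (acv _ T1); first lra.
  by have := ler_norm T; lra.
have FF : Filter (almost_everywhere (@lebesgue_measure R)) := ae_filter_ringOfSetsType _.
have ae_x' : {ae (@lebesgue_measure R), forall t : R, T0 <= t -> is_derive t (1 : R) x (v t)}.
  by apply: (@filterS _ _ FF _ _ _ ae_x) => t h Tt; apply: h; lra.
have ae_v' : {ae (@lebesgue_measure R), forall t : R, T0 <= t ->
    is_derive t (1 : R) v (g t - gam t *: v t - gradPhi (x t))}.
  apply: (@filterS _ _ FF _ _ _ ae_v) => t h Tt.
  have [h1 h2] : derivable v t 1 /\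
     'D_1 v t + (c / (1 + t) `^ alpha) *: v t + gradPhi (x t) = g t by apply: h; lra.
  split=> //; rewrite -h2 -/(gam t).
  by rewrite [RHS]addrAC !addrK.
have k0 t : 0 <= k t.
  by rewrite /k patchE; case: ifP => // _; rewrite mulr_ge0 ?mulr_ge0 ?powR_ge0// ltW.
have kE t : T0 <= t -> k t = p t * `|g t|.
  move=> Tt; rewrite /k patchE mem_set ?mulrA//=.
  by rewrite in_itv/= andbT; lra.
have kint : (@lebesgue_measure R).-integrable setT (EFin \o k).
  rewrite /k -restrict_EFin -integrable_mkcond//.
  have m1 : measurable_fun (`[0%R, +oo[%classic : set R) (fun t => (1 + t) `^ alpha * `|g t|).
    apply: measurable_funM => //.
    apply: (@measurableT_comp _ _ _ _ _ _ (@powR R ^~ alpha)).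
      exact: measurable_powR.
    by apply: measurable_funD.
  have := @integrableZl _ _ R (@lebesgue_measure R) (`[0%R, +oo[%classic : set R) _
    c^-1 (fun t => ((1 + t) `^ alpha * `|g t|)%:E).
  apply => //.
  apply/integrableP; split; first exact/measurable_EFinP.
  apply: le_lt_trans gint; rewrite le_eqVlt; apply/orP; left; apply/eqP.
  apply: eq_integral => t _; rewrite gee0_abs// lee_fin mulr_ge0// powR_ge0//.
(* The lower bound [pmin] of [p] is [c^-1], since [(1 + t)^alpha >= 1]. *)
have hc := trajectory_cauchy _ _ _ hip dPhi cPhi cgrad _ _ rho0 hz p p1 p2 gam k g x v T0 c^-1
  ci0 p_ge gamp dp dp1 p1b p2b acp acp1 acx' acv' ae_x' ae_v' k0 kE kint.
have [xs hxs] : exists xs : H, x t @[t --> +oo] --> xs.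
  by apply: cvg_pinfty_of_cauchy => e /hc[T _ hT]; exists T.
exists xs => //.
apply: (gradient_eq0_min _ _ _ hip dPhi cPhi).
exact: (limit_gradient_eq0 _ _ _ hip dPhi cPhi cgrad _ _ rho0 hz p p1 p2 gam k g x v T0 c^-1
  ci0 p_ge gamp dp dp1 p1b p2b acp acp1 acx' acv' ae_x' ae_v' k0 kE kint).
Qed.
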